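(* There is a D-sequent that is provable in $\mathbf{D}^2_{\rm seq}$ but not provable in $\mathbf{D}^2_{\rm seq}$ without using cut rules.
   Context: Formulas are built from propositional variables and $\bot$ by $\to$ and $\Box$. $\Gamma,\Delta,\Pi,\Sigma,\ldots$ denote finite sets of formulas; commas denote union; $\Box\Gamma=\{\Box\gamma\mid\gamma\in\Gamma\}$. GL-sequents $\Gamma\Rightarrow\Delta$ and D-sequents $\Gamma\Rightarrow_{\mathsf D}\Delta$ are tagged pairs of finite sets of formulas. For each arrow $\blacktriangleright\in\{\Rightarrow,\Rightarrow_{\mathsf D}\}$, $\mathbf{LK}_{\blacktriangleright}$ has initial sequents $\varphi\blacktriangleright\varphi$ and $\bot\blacktriangleright\ $ (empty right side) and the rules: (weakening) from $\Gamma\blacktriangleright\Delta$ infer $\Gamma'\blacktriangleright\Delta'$, where $\Gamma\subseteq\Gamma'$, $\Delta\subseteq\Delta'$; ($\to$left) from $\Gamma\blacktriangleright\Delta,\varphi$ and $\psi,\Gamma\blacktriangleright\Delta$ infer $\varphi\to\psi,\Gamma\blacktriangleright\Delta$; ($\to$right) from $\varphi,\Gamma\blacktriangleright\Delta,\psi$ infer $\Gamma\blacktriangleright\Delta,\varphi\to\psi$; (cut) from $\Gamma\blacktriangleright\Delta,\varphi$ and $\varphi,\Pi\blacktriangleright\Sigma$ infer $\Gamma,\Pi\blacktriangleright\Delta,\Sigma$. Further rules: (GL$\Box$) from $\Gamma,\Box\Gamma,\Box\varphi\Rightarrow\varphi$ infer $\Box\Gamma\Rightarrow\Box\varphi$;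 (GLtoD) from $\Gamma,\Box\Gamma\Rightarrow\Box\Delta$ infer $\Box\Gamma\Rightarrow_{\mathsf D}\Box\Delta$. $\mathbf{D}^2_{\rm seq}$ consists of $\mathbf{LK}_{\Rightarrow}$, $\mathbf{LK}_{\Rightarrow_{\mathsf D}}$, (GL$\Box$), (GLtoD). *)

(* Defs.v *)
From HB Require Import structures.
From mathcomp Require Import all_boot.
From mathcomp Require Import finmap.

Set Implicit Arguments.
Unset Strict Implicit.
Unset Printing Implicit Defensive.

Local Open Scope fset_scope.

Inductive form : Type :=
  | Var of nat
  | Bot
  | Imp of form & form
  | Box of form.

(* [form] is embedded in generic trees to obtain the choiceType structure
   that {fset form} requires. *)
Fixpoint tree_of_form (A : form) : GenTree.tree nat :=
  match A with
  | Var n => GenTree.Leaf n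
  | Bot => GenTree.Node 0 [::]
  | Imp B C => GenTree.Node 1 [:: tree_of_form B; tree_of_form C]
  | Box B => GenTree.Node 2 [:: tree_of_form B]
  end.

Fixpoint form_of_tree (t : GenTree.tree nat) : form :=
  match t with
  | GenTree.Leaf n => Var n
  | GenTree.Node 1 [:: u; v] => Imp (form_of_tree u) (form_of_tree v)
  | GenTree.Node 2 [:: u] => Box (form_of_tree u)
  | _ => Bot
  end.

Lemma tree_of_formK : cancel tree_of_form form_of_tree.
Proof. by elim=> //= [B -> C ->|B ->]. Qed.

HB.instance Definition _ := Countable.copy form (can_type tree_of_formK).

Definition boxes (G : {fset form}) : {fset form} := [fset Box A | A in G].

Inductive arrow : Type := GLarrow | Darrow.

Record sequent : Type :=
  Sequent { tag : arrow; ant : {fset form}; suc : {fset form} }.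

Notation "G '=[' a ']=>' D" := (Sequent a G D)
  (at level 70, a at level 200, no associativity).

(* [D2seq true] is provability in the full calculus; [D2seq false] is
   provability without the cut rule of either arrow. *)
Inductive D2seq (cuts : bool) : sequent -> Prop :=
  | ax_id a A :
      D2seq cuts ([fset A] =[a]=> [fset A])
  | ax_bot a :
      D2seq cuts ([fset Bot] =[a]=> fset0)
  | weakening a G D G' D' :
      G `<=` G' -> D `<=` D' ->
      D2seq cuts (G =[a]=> D) ->
      D2seq cuts (G' =[a]=> D')
  | imp_left a G D A B :
      D2seq cuts (G =[a]=> D `|` [fset A]) ->
      D2seq cuts (B |` G =[a]=> D) ->
      D2seq cuts (Imp A B |` G =[a]=> D)
  | imp_right a G D A B :
      D2seq cuts (A |` G =[a]=> D `|` [fset B]) ->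
      D2seq cuts (G =[a]=> D `|` [fset Imp A B])
  | cut a G D P S A :
      cuts ->
      D2seq cuts (G =[a]=> D `|` [fset A]) ->
      D2seq cuts (A |` P =[a]=> S) ->
      D2seq cuts (G `|` P =[a]=> D `|` S)
  | GL_box G A :
      D2seq cuts (G `|` boxes G `|` [fset Box A] =[GLarrow]=> [fset A]) ->
      D2seq cuts (boxes G =[GLarrow]=> [fset Box A])
  | GL_to_D G D :
      D2seq cuts (G `|` boxes G =[GLarrow]=> boxes D) ->
      D2seq cuts (boxes G =[Darrow]=> boxes D).

(* Main.v *)
Require Import Defs.
From mathcomp Require Import all_boot finmap.

(** The witness is [Box (Box Bot)] =>_D (empty).  (GLtoD) turns
    [Box Bot => Box Bot] into [Box (Box Bot) =>_D Box Bot] and [Bot =>] into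
    [Box Bot =>_D], so a cut on [Box Bot] proves it.  Without cut, only (GLtoD)
    could strip a box, and its premise would be a GL-sequent whose antecedent
    still consists of boxed formulas and whose succedent is empty; no cut-free
    rule produces such a sequent. *)

Local Open Scope fset_scope.

Definition is_box (A : form) : Prop := exists B, A = Box B.

Definition is_box2 (A : form) : Prop := exists B, A = Box (Box B).

Lemma boxes0 : boxes fset0 = fset0.
Proof. exact: imfset0. Qed.

Lemma boxes1 (A : form) : boxes [fset A] = [fset Box A].
Proof. exact: imfset_fset1. Qed.

Lemma mem_boxes (A : form) (G : {fset form}) :
  A \in boxes G -> exists2 B, B \in G & A = Box B.
Proof. by case/imfsetP=> B GB ->; exists B. Qed.

Lemma fsetU1_neq0 (D : {fset form}) (A : form) : D `|` [fset A] <> fset0.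
Proof. by move=> D0; have := in_fset0 A; rewrite -D0 !inE eqxx orbT. Qed.

Lemma fset1_neq0 (A : form) : [fset A] <> fset0.
Proof. by rewrite -(fset0U [fset A]); exact: fsetU1_neq0. Qed.

(** The premise of (GLtoD) contains [G] as well as [boxes G], so its antecedent consists of boxes
    only if that of the conclusion consists of double boxes; hence the stronger condition for
    [Darrow]. *)
Lemma cut_free_suc_neq0 (s : sequent) :
  D2seq false s ->
  (forall A, A \in ant s ->
     match Defs.tag s with GLarrow => is_box A | Darrow => is_box2 A end) ->
  suc s <> fset0.
Proof.
elim=> {s} //=.
- by move=> a A _; exact: fset1_neq0.
- move=> a /(_ Bot); rewrite !inE eqxx => /(_ isT).
  by case: a => -[].
- move=> a G D G' D' sG sD _ IH boxG' D'0.
  apply: IH => [A /(fsubsetP sG)|]; first exact: boxG'.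
  by apply/eqP; rewrite -fsubset0 -D'0.
(* As with [Bot] above, the principal formula is not a box. *)
- move=> a G D A B _ _ _ _ /(_ (Imp A B)); rewrite !inE eqxx => /(_ isT).
  by case: a => -[].
- by move=> a G D A B _ _ _; exact: fsetU1_neq0.
- by move=> G A _ _ _; exact: fset1_neq0.
- move=> G D _ IH box2G; apply: IH => A; rewrite inE => /orP[GA|].
    have /box2G[B [->]] : Box A \in boxes G by rewrite in_imfset.
    by exists B.
  by case/mem_boxes=> B _ ->; exists B.
Qed.

Theorem theorem4p9 :
  exists G D : {fset form},
    D2seq true (G =[Darrow]=> D) /\ ~ D2seq false (G =[Darrow]=> D).
Proof.
exists [fset Box (Box Bot)], fset0; split; last first.
  move=> /cut_free_suc_neq0 /=; apply=> // A.
  by rewrite inE => /eqP ->; exists Bot.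
have left : D2seq true
    ([fset Box (Box Bot)] =[Darrow]=> fset0 `|` [fset Box Bot]).
  rewrite fset0U -!boxes1; apply: GL_to_D.
  apply: weakening (ax_id _ _ (Box Bot)); rewrite boxes1 ?fsubset_refl //.
  exact: fsubsetUl.
have right : D2seq true (Box Bot |` fset0 =[Darrow]=> fset0).
  (* The empty succedent counts as [boxes fset0], so (GLtoD) applies. *)
  rewrite fsetU0 -boxes1 -boxes0; apply: GL_to_D.
  by apply: weakening (ax_bot _ _); [exact: fsubsetUl | exact: fsub0set].
by have := cut isT left right; rewrite !fsetU0.
Qed.
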